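(* Let $(R,\mathfrak m)$ be a two-dimensional regular local ring with infinite residue field, let $x,y$ be a regular system of parameters for $R$, and let $I$ be an $\mathfrak m$-primary monomial ideal with respect to $x,y$, written as $I=(x^{a_i}y^{b_i}\mid 0\le i\le r)$ with $a_0>a_1>\dots>a_{r-1}>a_r=0$ and $b_0=0<b_1<\dots<b_{r-1}<b_r$. Suppose that $I$ is integrally closed. Then for any $1\le k\le r-1$, the module $M_k$ associated to $I$ and $k$ is integrally closed with $I(M_k)=I$.
   Context: A monomial ideal with respect to $x,y$ is an ideal of $R$ generated by elements $x^ay^b$ with $a,b\ge 0$. For an integer $1\le k<b_r$, the module $M_k=M_k(I)$ is the submodule of the free module $F=R^2$ generated by the columns of the $2\times(r+2)$ matrix $$\begin{pmatrix} x^{a_0-1} & \cdots & x^{a_i-1}y^{b_i} & \cdots & x^{a_{r-1}-1}y^{b_{r-1}} & y^k & 0\\ 0&\cdots&0&\cdots&0&x&y^{b_r-k}\end{pmatrix}$$ (the first $r$ columns are indexed by $0\le i\le r-1$). The quotient $F/M_k$ has finite length. Let $K$ be the quotient field of $R$. For a finitely generated torsion-free $R$-module $M$, the integral closure $\overline M$ is the set of $f\in M_K=M\otimes_RK$ such that $f\in MV$ (the $V$-submodule of $M_K$ generated by $M$) for every discrete valuation ring $V$ with $R\subset V\subset K$; $M$ is integrally closed if $\overline M=M$. $I(M):=\operatorname{Fitt}_0(M^{**}/M)$, where $M^{**}$ is the double $R$-dual, a free module canonically containing $M$ with quotient of finite length; if $M\subset G$ with $G$ free and $G/M$ of finite length,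 then $M^{**}/M\cong G/M$. Thus $I(M_k)=\operatorname{Fitt}_0(F/M_k)$ is the ideal generated by the $2\times2$ minors of the matrix $\begin{pmatrix} x^{a_0-1} & \cdots & x^{a_i-1}y^{b_i} & \cdots & x^{a_{r-1}-1}y^{b_{r-1}} & y^k & 0\\ 0&\cdots&0&\cdots&0&x&y^{b_r-k}\end{pmatrix}$. *)

(* Defs.v *)
From HB Require Import structures.
From mathcomp Require Import all_boot all_order all_algebra.
From mathcomp Require Import ring_quotient.
From mathcomp Require Import boolp classical_sets functions cardinality.

Set Implicit Arguments.
Unset Strict Implicit.
Unset Printing Implicit Defensive.

Import Order.TTheory GRing.Theory Num.Theory.
Local Open Scope classical_set_scope.
Local Open Scope ring_scope.

(* The finite sums of terms c *: u with c in C and u in N. *)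
Definition span_over (A : pzRingType) (V : lmodType A) (C : set A) (N : set V) :
    set V :=
  [set f | exists n (c : 'I_n -> A) (u : 'I_n -> V),
    (forall i, C (c i) /\ N (u i)) /\ f = \sum_(i < n) c i *: u i].

Section Ideals.
Variable R : comNzRingType.
Implicit Types (I J m : set R).

(* Unlike idealr_closed, this allows the unit ideal. *)
Definition is_ideal J := @submod_closed R R^o [in J].

Definition ideal_gen (S : set R) : set R := @span_over R R^o setT S.

Definition noetherian_ring :=
  forall J, is_ideal J -> exists s : seq R, J = ideal_gen [set` s].

Definition maximal_ideal m :=
  [/\ is_ideal m, m <> setT
    & forall J, is_ideal J -> m `<=` J -> J = m \/ J = setT].

Definition local_ring m := forall J, maximal_ideal J <-> J = m.

Definition is_prime_ideal (P : set R) :=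
  idealr_closed [in P] /\ prime_idealr_closed [in P].

Definition prime_chain (n : nat) (P : nat -> set R) :=
  (forall i, (i <= n)%N -> is_prime_ideal (P i)) /\
  (forall i, (i < n)%N -> P i `<` P i.+1).

Definition krull_dimension (d : nat) :=
  (exists P : nat -> set R, prime_chain d P) /\
  (forall n (P : nat -> set R), prime_chain n P -> (n <= d)%N).

Definition regular_local_ring m (d : nat) :=
  [/\ noetherian_ring, local_ring m, krull_dimension d
    & exists s : 'I_d -> R, m = ideal_gen (range s)].

(* The elements of R / m, as cosets. *)
Definition residue_set m : set (set R) :=
  [set [set b | m (b - a)] | a in [set: R]].

Definition radical I : set R := [set f | exists n, I (f ^+ n)].

Definition primary_to m I :=
  [/\ is_ideal I, I <> setT,
      forall u v, I (u * v) -> I u \/ radical I v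
    & radical I = m].

End Ideals.

(* The R-dual Hom_R(U, R) of an R-module U, as an R-module. *)
Section Dual.
Variables (R : comNzRingType) (U : lmodType R).

Definition linear_forms : {pred U -> R^o} := fun f => `[< linear f >].

Lemma linear_forms_submod : submod_closed linear_forms.
Proof.
split=> [|a f g].
  by apply/asboolP => b u v; rewrite scaler0 addr0.
move=> /asboolP flin /asboolP glin; apply/asboolP => b u v /=.
rewrite !fctE /= flin glin !scalerDr !scalerA [a * b]mulrC.
by rewrite addrACA.
Qed.

HB.instance Definition _ :=
  GRing.isSubmodClosed.Build R (U -> R^o) linear_forms linear_forms_submod.

Definition dual := {f : U -> R^o | f \in linear_forms}.

HB.instance Definition _ := SubChoice.on dual.
HB.instance Definition _ := [SubChoice_isSubLmodule of dual by <:].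

End Dual.

Section Bidual.
Variables (R : comNzRingType) (U : lmodType R).

Lemma eval_linear (u : U) :
  (fun f : dual U => val f u : R^o) \in @linear_forms R (dual U).
Proof. by apply/asboolP. Qed.

Definition bidual : lmodType R := dual (dual U).
Definition bidual_map (u : U) : bidual :=
  exist _ (fun f : dual U => val f u : R^o) (eval_linear u).

End Bidual.

(* The initial Fitting ideal of G / N, where N is a submodule of G: the ideal
   generated by the n x n minors of the relations between n generators
   e_1, ..., e_n of G / N.  By Fitting's lemma this ideal does not depend on
   the generators, so that the union over all of them taken here is the ideal
   given by any one of them. *)
Definition fitting0 (R : comNzRingType) (G : lmodType R) (N : set G) : set R :=
  [set f | exists n (e : 'I_n -> G),
    (forall g, exists c : 'I_n -> R, N (g - \sum_(j < n) c j *: e j)) /\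
    ideal_gen
      [set \det B | B in
        [set B : 'M[R]_n | forall i, N (\sum_(j < n) B i j *: e j)]] f].

(* I(U) = Fitt_0(U** / U). *)
Definition ideal_of_module (R : comNzRingType) (U : lmodType R) : set R :=
  fitting0 (range (@bidual_map R U)).

Section ColumnModule.
Variables (R : comNzRingType) (n p : nat) (A : 'M[R]_(n, p)).

Definition colspan : set 'cV[R]_n := range (mulmx A : 'cV[R]_p -> 'cV[R]_n).

Lemma colspan_submod : submod_closed [in colspan].
Proof.
split=> [|a _ _ /set_mem[u _ <-] /set_mem[v _ <-]]; apply/mem_set.
  by exists 0; rewrite ?mulmx0.
by exists (a *: u + v); rewrite // mulmxDr scalemxAr.
Qed.

Definition in_colspan : {pred 'cV[R]_n} := [in colspan].

HB.instance Definition _ :=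
  GRing.isSubmodClosed.Build R 'cV[R]_n in_colspan colspan_submod.

Definition colmodule := {v : 'cV[R]_n | v \in in_colspan}.

HB.instance Definition _ := SubChoice.on colmodule.
HB.instance Definition _ := [SubChoice_isSubLmodule of colmodule by <:].

End ColumnModule.

(* V is the valuation ring of a discrete valuation v of K; the value v 0 is
   irrelevant. *)
Definition is_dvr_of (K : fieldType) (V : set K) :=
  exists v : K -> int,
    [/\ exists2 t, t != 0 & v t = 1,
        forall f g, f != 0 -> g != 0 -> v (f * g) = v f + v g,
        forall f g, f != 0 -> g != 0 -> f + g != 0 ->
          Num.min (v f) (v g) <= v (f + g)
      & V = [set f | f != 0 -> 0 <= v f]].

Section IntegralClosure.
Variable R : idomainType.
Let K := {fraction R}.

(* A finitely generated torsion-free R-module is taken here as an R-submodule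
   M of a K-vector space E, so that the K-span of M in E is M_K. *)
Definition integral_closure (E : lmodType K) (M : set E) : set E :=
  [set f | span_over setT M f /\
    forall V : set K, is_dvr_of V -> range (@tofrac R) `<=` V ->
      span_over V M f].

Definition integrally_closed (E : lmodType K) (M : set E) :=
  integral_closure M = M.

Definition integrally_closed_ideal (I : set R) :=
  @integrally_closed K^o (@tofrac R @` I).

Definition integrally_closed_columns n p (A : 'M[R]_(n, p)) :=
  integrally_closed (map_mx (@tofrac R) @` colspan A).

End IntegralClosure.

(* The matrix whose columns generate M_k. *)
Definition monomial_module_mx (R : comNzRingType) (x y : R) (r : nat)
    (a b : nat -> nat) (k : nat) : 'M[R]_(1 + 1, r + (1 + 1)) :=
  block_mx
    (\row_(i < r) (x ^+ (a i - 1) * y ^+ b i)) (row_mx (y ^+ k)%:M 0)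
    0 (row_mx x%:M (y ^+ (b r - k))%:M).

(* Main.v *)
Require Import Defs.
From HB Require Import structures.
From mathcomp Require Import all_boot all_order all_algebra.
From mathcomp Require Import boolp classical_sets functions cardinality.
From mathcomp Require Import ring zify.

Set Implicit Arguments.
Unset Strict Implicit.
Unset Printing Implicit Defensive.

Import Order.TTheory GRing.Theory Num.Theory.
Local Open Scope classical_set_scope.
Local Open Scope ring_scope.

(** Write b for b_r and P for the ideal generated by the x^(a_i - 1) y^(b_i)
    with i < r, so that I = x P + y^b R. The module M = M_k consists of the
    sums of the columns (p, 0) with p in P, the multiples of w = (y^k, x), and
    the multiples of (0, y^(b - k)). The form cross w u = det (w | u) kills w
    and maps (p, 0) and (0, y^(b - k)) to - x p and y^b; hence it maps M onto
    I ([cross_onto]). Its kernel in R^2 is R w, since x, y is a regular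
    sequence, so that M = {u | cross w u in I}. Conversely all the 2 x 2 minors
    of M lie in I ([cross_in]): this amounts to y^(b - k) P being contained in
    I, which the strict monotonicity of the exponents gives for k <= r - 1
    ([monomial_minor]).

    Integral closedness ([integrally_closed_rank2]). Linear maps carry integral
    closures into integral closures. For c in M the linear form cross c maps M
    into I, hence the integral closure of M into that of I, which is I. So if f
    is integral over M, then cross w f is in I, and f = u + h w with u in M and
    h in the fraction field. Taking for c the columns (0, y^(b - k)) and
    (x^(a_0 - 1), 0), one finds y^b h and x^(a_0) h in R; as these powers of
    x and y form a regular sequence, h is in R and f is in M.

    The Fitting ideal ([ideal_of_rank2]). M contains s R^2 and t R^2 for the
    regular sequence s = x^(a_0), t = y^b, so every linear form on M extends to
    R^2; thus M** is R^2 and M -> M** is the inclusion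
    ([ideal_of_colmodule]). Fitting's lemma for submodules of R^n
    ([fitting0_column]) turns I(M) into the ideal of the 2 x 2 minors, which is
    I by the first paragraph.

    A system of parameters is a regular sequence ([parameters_regular]). Modulo
    x every element is zero or a unit times a power of y
    ([parameter_expansion]), so it suffices that no power of y is a multiple
    of x. Otherwise a nonzero prime Q different from m does not contain x, and
    it is principal by Nakayama's lemma, because the ideals of R / (x) are
    generated by powers of y. Let q generate Q. A power of q is a multiple of
    x, and since x is not in Q one can cancel q from q^n = x d until x divides
    1 ([parameter_not_nilpotent]). *)

(** * Ideals and their generators *)

Section Ideals.
Variable R : comNzRingType.
Implicit Types (J S : set R).

Lemma is_idealP J :
  is_ideal J <-> J 0 /\ forall c u v, J u -> J v -> J (c * u + v).
Proof.
split=> [[J0 Jlin]|[J0 Jlin]].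
  split=> [|c u v Ju Jv]; first exact: set_mem.
  by apply: set_mem; apply: (Jlin c u v); apply/mem_set.
by split=> [|c u v /set_mem Ju /set_mem Jv]; apply/mem_set => //; apply: Jlin.
Qed.

Section Closure.
Variables (J : set R) (idJ : is_ideal J).

Lemma ideal0 : J 0. Proof. by have /is_idealP[] := idJ. Qed.

Lemma idealMl c u : J u -> J (c * u).
Proof.
by have /is_idealP[J0 Jlin] := idJ => Ju; rewrite -[_ * _]addr0; apply: Jlin.
Qed.

Lemma idealD u v : J u -> J v -> J (u + v).
Proof.
by have /is_idealP[J0 Jlin] := idJ => Ju Jv; rewrite -[u]mul1r; apply: Jlin.
Qed.

Lemma idealB u v : J u -> J v -> J (u - v).
Proof.
by move=> Ju Jv; apply: idealD => //; rewrite -mulN1r; apply: idealMl.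
Qed.

Lemma ideal_sum (T : finType) (F : T -> R) :
  (forall i, J (F i)) -> J (\sum_i F i).
Proof.
by move=> JF; apply: (big_ind J) => //; [exact: ideal0 | exact: idealD].
Qed.

Lemma ideal_unit c u : J u -> c * u = 1 -> J = setT.
Proof.
move=> Ju cu; apply/seteqP; split=> // f _.
by rewrite -[f]mulr1 -cu; do 2! apply: idealMl.
Qed.

End Closure.

Lemma ideal_gen_ideal S : is_ideal (ideal_gen S).
Proof.
apply/is_idealP; split=> [|d _ _ [n [c [u [Su ->]]]] [p [e [v [Sv ->]]]]].
  by exists 0%N, (fun=> 0), (fun=> 0); split=> [[]//|]; rewrite big_ord0.
exists (n + p)%N.
exists (fun i : 'I_(n + p) =>
  match fintype.split i with inl j => d * c j | inr j => e j end).
exists (fun i : 'I_(n + p) =>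
  match fintype.split i with inl j => u j | inr j => v j end).
split=> [i|].
  by split=> //; case: fintype.split => j; [apply: (Su j).2|apply: (Sv j).2].
rewrite big_split_ord /= mulr_sumr; congr (_ + _); apply: eq_bigr => i _.
  by rewrite (unsplitK (inl i)) -scalerA.
by rewrite (unsplitK (inr i)).
Qed.

Lemma ideal_gen_incl S u : S u -> ideal_gen S u.
Proof.
move=> Su; exists 1%N, (fun=> 1), (fun=> u); split=> //.
by rewrite big_ord1 scale1r.
Qed.

Lemma ideal_gen_sub S J : is_ideal J -> S `<=` J -> ideal_gen S `<=` J.
Proof.
move=> idJ SJ _ [n [c [u [Su ->]]]]; apply: ideal_sum => // i.
by apply: idealMl => //; apply: SJ; apply: (Su i).2.
Qed.

Lemma ideal_gen2P (s t f : R) :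
  ideal_gen [set s; t] f <-> exists c d, f = c * s + d * t.
Proof.
have idG := ideal_gen_ideal [set s; t].
split=> [|[c [d ->]]]; last first.
  by apply: idealD => //; apply: idealMl => //; apply: ideal_gen_incl;
    [left|right].
apply: (ideal_gen_sub (J := [set g | exists c d, g = c * s + d * t]));
  last first.
  by move=> _ [->|->]; [exists 1, 0|exists 0, 1]; ring.
apply/is_idealP; split; first by exists 0, 0; ring.
move=> e _ _ [c [d ->]] [c' [d' ->]].
by exists (e * c + c'), (e * d + d'); ring.
Qed.

Lemma ideal_gen_family n (F : 'I_n -> R) f :
  ideal_gen (range F) f <-> exists c : 'I_n -> R, f = \sum_i c i * F i.
Proof.
have idG := ideal_gen_ideal (range F); split=> [|[c ->]]; last first.
  apply: ideal_sum => // i; apply: idealMl => //.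
  by apply: ideal_gen_incl; exists i.
apply: (ideal_gen_sub
  (J := [set g | exists c : 'I_n -> R, g = \sum_i c i * F i])).
  apply/is_idealP; split.
    by exists (fun=> 0); rewrite big1 // => i _; rewrite mul0r.
  move=> e _ _ [c ->] [c' ->]; exists (fun i => e * c i + c' i).
  by rewrite mulr_sumr -big_split; apply: eq_bigr => i _ /=; ring.
move=> _ [i _ <-]; exists (fun j => (j == i)%:R).
rewrite (bigD1 i) //= eqxx mul1r big1 ?addr0 // => j /negPf ->.
by rewrite mul0r.
Qed.

Definition multiples s : set R := [set f | exists h, f = h * s].

Lemma multiples_ideal s : is_ideal (multiples s).
Proof.
apply/is_idealP; split=> [|c _ _ [h ->] [g ->]].
  by exists 0; rewrite mul0r.
by exists (c * h + g); ring.
Qed.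

Definition adjoin J f : set R := [set g | exists d, J (g - d * f)].

Lemma adjoin_ideal J f : is_ideal J -> is_ideal (adjoin J f).
Proof.
move=> idJ; apply/is_idealP; split.
  by exists 0; rewrite mul0r subr0; apply: ideal0.
move=> c u v [d Ju] [e Jv]; exists (c * d + e).
have -> : c * u + v - (c * d + e) * f = c * (u - d * f) + (v - e * f) by ring.
by apply: idealD => //; apply: idealMl.
Qed.

End Ideals.

(** * Noetherian local rings *)

Section NoetherianLocal.
Variables (R : comNzRingType) (m : set R).
Hypotheses (noethR : noetherian_ring R) (locR : local_ring m).
Implicit Types (J P : set R) (F : set (set R)).

Lemma noetherian_max F J0 : F J0 -> (forall J, F J -> is_ideal J) ->
  exists2 J, F J & forall J', F J' -> J `<=` J' -> J' `<=` J.
Proof.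
move=> FJ0 idF; apply: contrapT => nomax.
have step J : exists J', F J -> [/\ F J', J `<=` J' & ~ J' `<=` J].
  have [FJ|] := pselect (F J); last by exists J.
  apply: contrapT => nostep; apply: nomax; exists J => // J' FJ' JJ'.
  by apply: contrapT => J'J; apply: nostep; exists J'.
have [next nextP] := choice step.
pose C n := iter n next J0.
have FC n : F (C n) by elim: n => //= n /nextP[].
have Cmono n p : (n <= p)%N -> C n `<=` C p.
  move=> /subnK <-; elim: (p - n)%N => //= q IHq f /IHq.
  by have [_ + _] := nextP _ (FC (q + n)%N); apply.
have idU : is_ideal (\bigcup_n C n).
  apply/is_idealP; split; first by exists 0%N => //; apply: ideal0; apply: idF.
  move=> c u v [n _ Cu] [p _ Cv]; exists (maxn n p) => //.
  have idC := idF _ (FC (maxn n p)).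
  apply: idealD => //; last by apply: Cmono Cv; apply: leq_maxr.
  by apply: idealMl => //; apply: Cmono Cu; apply: leq_maxl.
have [s Us] := noethR idU.
have [n sC] : exists n, [set` s] `<=` C n.
  have : [set` s] `<=` \bigcup_n C n by rewrite Us; apply: ideal_gen_incl.
  elim: s {Us} => [|f s IHs] sU; first by exists 0%N.
  have [|n sC] := IHs.
    by move=> g /= sg; apply: sU; rewrite /= in_cons sg orbT.
  have [p _ fC] : (\bigcup_n C n) f by apply: sU; rewrite /= mem_head.
  exists (maxn n p) => g /=; rewrite in_cons => /orP[/eqP->|/sC].
    by apply: Cmono fC; apply: leq_maxr.
  by apply: Cmono; apply: leq_maxl.
have [_ _] := nextP _ (FC n); apply => f fC.
have: (\bigcup_n C n) f by exists n.+1.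
by rewrite Us; apply: ideal_gen_sub => //; apply: idF.
Qed.

(** Noetherianity replaces Zorn's lemma: an ideal maximal among the proper
    ideals containing J is a maximal ideal, hence m. *)
Lemma local_proper J : is_ideal J -> J <> setT -> J `<=` m.
Proof.
move=> idJ JT.
pose F := [set L | [/\ is_ideal L, L <> setT & J `<=` L]].
have [||L [idL LT JL] maxL] := @noetherian_max F J.
- by split.
- by move=> L [].
suff <- : L = m by [].
apply/(locR L); split=> // L' idL' LL'.
have [->|L'T] := pselect (L' = setT); first by right.
left; apply/seteqP; split=> //; apply: maxL => //.
by split=> //; apply: subset_trans LL'.
Qed.

Lemma local_max : maximal_ideal m. Proof. exact/(locR m). Qed.

Lemma local_ideal : is_ideal m. Proof. by have [] := local_max. Qed.

Lemma local1 : ~ m 1.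
Proof.
have [idm mT _] := local_max => m1; apply: mT.
by apply: (ideal_unit (c := 1) idm m1); rewrite mulr1.
Qed.

Lemma local_unit f : ~ m f -> exists g, g * f = 1.
Proof.
move=> mf; apply: contrapT => nof; apply: mf.
apply: (local_proper (multiples_ideal f)); last by exists 1; rewrite mul1r.
move=> fT; have [g E] : multiples f 1 by rewrite fT.
by apply: nof; exists g; rewrite E.
Qed.

(** A form of Nakayama's lemma, P contained in J + t P implies P contained in
    J, for an arbitrary set P. The elements f, g, ... obtained by dividing by t
    repeatedly generate increasing ideals modulo J; where they stop growing
    g = d f = d t g modulo J, and 1 - d t is a unit. *)
Lemma krull_nakayama J P t : is_ideal J -> m t ->
  (forall f, P f -> exists2 g, P g & J (f - t * g)) -> P `<=` J.
Proof.
move=> idJ mt PJ f0 Pf0; apply: contrapT => Jf0.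
pose F := [set L | exists f, [/\ P f, ~ J f & L = adjoin J f]].
have [|_ [f [_ _ ->]]|_ [f [Pf Jf ->]] maxf] := @noetherian_max F (adjoin J f0).
- by exists f0.
- exact: adjoin_ideal.
have [g Pg Jfg] := PJ _ Pf.
have Jg : ~ J g.
  move=> Jg; apply: Jf; rewrite -[f](subrK (t * g)).
  by apply: idealD => //; apply: idealMl.
have [|||d Jd] := maxf (adjoin J g) _ _ g.
- by exists g.
- move=> h [d Jh]; exists (d * t).
  have -> : h - d * t * g = (h - d * f) + d * (f - t * g) by ring.
  by apply: idealD => //; apply: idealMl.
- by exists 1; rewrite mul1r subrr; apply: ideal0.
have [e eE] : exists e, e * (1 - d * t) = 1.
  apply: local_unit => mdt; apply: local1; rewrite -[1](subrK (d * t)).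
  have idm := local_ideal.
  by apply: idealD => //; apply: idealMl.
apply: Jg; have -> : g = e * (1 - d * t) * g by rewrite eE mul1r.
have -> : e * (1 - d * t) * g = e * ((g - d * f) + d * (f - t * g)) by ring.
by apply: idealMl => //; apply: idealD => //; apply: idealMl.
Qed.

End NoetherianLocal.

(** * Systems of parameters are regular sequences *)

Definition regular_pair (R : comNzRingType) (s t : R) :=
  forall f g, s * f = t * g -> exists h, g = s * h.

Section RegularPair.
Variable R : idomainType.
Implicit Types (s t : R).

Lemma regular_pair_sym s t : s != 0 -> regular_pair s t -> regular_pair t s.
Proof.
move=> s0 st f g E; have [h fE] := st _ _ (esym E).
by exists h; apply: (mulfI s0); rewrite -E fE; ring.
Qed.

Lemma regular_pairXr s t n : regular_pair s t -> regular_pair s (t ^+ n).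
Proof.
move=> st; elim: n => [|n IHn] f g; first by rewrite mul1r => <-; exists f.
by rewrite exprS -mulrA => /st[h /esym/IHn].
Qed.

Lemma regular_pairX s t p q : s != 0 -> t != 0 ->
  regular_pair s t -> regular_pair (s ^+ p) (t ^+ q).
Proof.
move=> s0 t0 st; have /regular_pair_sym ts := regular_pairXr (n := q) st.
apply: regular_pair_sym; first exact: expf_neq0.
exact/regular_pairXr/ts.
Qed.

End RegularPair.

Section SystemOfParameters.
Variables (R : idomainType) (m : set R).
Hypotheses (noethR : noetherian_ring R) (locR : local_ring m).
Implicit Types (x y f g : R) (Q : set R).

(** R / (x) has the principal maximal ideal (y). An element that is not a unit
    times a power of y modulo x is y times another such element modulo x, so
    that these elements all vanish modulo x by [krull_nakayama]. *)
Lemma parameter_expansion x y : m = ideal_gen [set x; y] ->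
  forall f, multiples x f \/
    exists j u, [/\ ~ m u & multiples x (f - u * y ^+ j)].
Proof.
move=> mxy f; have idm := local_ideal locR.
have mP g : m g <-> exists c d, g = c * x + d * y.
  by rewrite mxy; apply: ideal_gen2P.
have [|nof] := pselect (exists j u, [/\ ~ m u & multiples x (f - u * y ^+ j)]).
  by right.
left; pose P :=
  [set g | ~ exists j u, [/\ ~ m u & multiples x (g - u * y ^+ j)]].
have my : m y by apply/mP; exists 0, 1; ring.
apply: (krull_nakayama noethR locR (multiples_ideal x) my (P := P)) nof => g Pg.
have /mP[c [d gE]] : m g.
  apply: contrapT => mg; apply: Pg; exists 0%N, g; split=> //.
  by exists 0; rewrite mulr1 subrr mul0r.
exists d; last by exists c; rewrite gE; ring.
move=> [j [u [mu [h dE]]]]; apply: Pg; exists j.+1, u; split=> //.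
exists (c + h * y); rewrite gE exprS -[d](subrK (u * y ^+ j)) dE; ring.
Qed.

(** This is the case of Krull's principal ideal theorem in which the maximal
    ideal is nilpotent modulo x: no nonzero prime Q lies strictly below m. *)
Lemma parameter_not_nilpotent x y Q N : m = ideal_gen [set x; y] ->
  is_prime_ideal Q -> Q `<` m -> (exists2 q, Q q & q != 0) ->
  ~ multiples x (y ^+ N).
Proof.
move=> mxy [[Q0 Q1 Qlin] Qprime] [Qm mQ] [q0 Qq0 q0nz] yN.
have idm := local_ideal locR.
have idQ : is_ideal Q by split.
have mP g : m g <-> exists c d, g = c * x + d * y.
  by rewrite mxy; apply: ideal_gen2P.
have primeQ f g : Q (f * g) -> Q f \/ Q g.
  by move=> /mem_set/Qprime/orP[] /set_mem; [left|right].
have notQ1 : ~ Q 1 by move=> /mem_set; apply/negP.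
have primeQX f n : Q (f ^+ n) -> Q f.
  by elim: n => [/notQ1//|n IHn]; rewrite exprS => /primeQ[].
have mx : m x by apply/mP; exists 1, 0; ring.
have Qx : ~ Q x.
  move=> Qx; have Qy : Q y.
    by apply: (primeQX _ N); have [h ->] := yN; apply: idealMl.
  by apply: mQ => g /mP[c [d ->]]; apply: idealD => //; apply: idealMl.
have cancelQ g : Q (x * g) -> Q g by move=> /primeQ[].
have exi : exists i, `[< exists g, Q (y ^+ i + x * g) >].
  exists N; apply/asboolP; have [h ->] := yN; exists (- h).
  by have -> : h * x + x * - h = 0 by [ring]; apply: ideal0.
(* The image of Q in R / (x) is generated by its least power of y; q lifts
   that power, so that Q is contained in (q) + x R, hence in (q) + x Q. *)
case: (ex_minnP exi) => i /asboolP[g Qq] mini.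
set q := y ^+ i + x * g in Qq.
have Qgen : Q `<=` multiples q.
  apply: (krull_nakayama noethR locR (multiples_ideal q) mx) => f Qf.
  have [[h fE]|[j [u [mu [h fE]]]]] := parameter_expansion mxy f.
    exists h; first by apply: cancelQ; rewrite mulrC -fE.
    by exists 0; rewrite fE; ring.
  have {}fE : f = u * y ^+ j + x * h by rewrite [x * h]mulrC -fE; ring.
  have [w wu] := local_unit noethR locR mu.
  have ij : (i <= j)%N.
    apply: mini; apply/asboolP; exists (w * h).
    have -> : y ^+ j + x * (w * h) = w * f.
      by rewrite fE mulrDr [w * (u * _)]mulrA wu mul1r; ring.
    exact: idealMl.
  have fqE : f - u * y ^+ (j - i) * q = x * (h - u * y ^+ (j - i) * g).
    by rewrite fE -{1}(subnK ij) exprD /q; ring.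
  exists (h - u * y ^+ (j - i) * g); last first.
    by exists (u * y ^+ (j - i)); rewrite -fqE; ring.
  by apply: cancelQ; rewrite -fqE; apply: idealB => //; apply: idealMl.
have qnz : q != 0.
  apply: contra_neq q0nz => q_eq0; have [h ->] := Qgen _ Qq0.
  by rewrite q_eq0 mulr0.
(* From q^(n+1) = x h, the prime Q = (q) contains h, and q cancels. *)
have qX n : ~ multiples x (q ^+ n).
  elim: n => [|n IHn] [h]; rewrite ?expr0 => hE.
    by apply: (local1 locR); rewrite hE; apply: idealMl.
  have : Q (x * h) by rewrite mulrC -hE exprS mulrC; apply: idealMl.
  move=> /cancelQ/Qgen[d dE]; apply: IHn; exists d.
  by apply: (mulfI qnz); rewrite -exprS hE dE; ring.
have /mP[c [d qE]] := Qm _ Qq.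
apply: (qX N).
have [h yE] := yN.
have [g' qNE] : exists g', q ^+ N - (d * y) ^+ N = (c * x) * g'.
  by rewrite subrXX qE addrK; eexists.
exists (c * g' + d ^+ N * h).
rewrite -[q ^+ N](subrK ((d * y) ^+ N)) qNE exprMn yE; ring.
Qed.

(** The middle term of a chain of three primes. *)
Lemma exists_intermediate_prime : krull_dimension R 2 ->
  exists Q, [/\ is_prime_ideal Q, Q `<` m & exists2 q, Q q & q != 0].
Proof.
move=> [[P [Pprime Plt]] _]; exists (P 1%N).
have idP i : (i <= 2)%N -> is_ideal (P i) /\ P i <> setT.
  move=> /Pprime[[P0 P1 Plin] _]; split; first by split.
  by move=> PT; move: P1; rewrite PT in_setT.
split; first exact: Pprime.
  have [idP2 P2T] := idP 2%N isT.
  have [P12 P21] := Plt 1%N isT.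
  have P2m := local_proper noethR locR idP2 P2T.
  split; first exact: subset_trans P2m.
  by move=> mP1; apply: P21; apply: subset_trans mP1.
have [P01 P10] := Plt 0%N isT.
apply: contrapT => noq; apply: P10 => q Pq.
have [->|qnz] := eqVneq q 0; first by apply: ideal0; apply: (idP 0%N isT).1.
by case: noq; exists q.
Qed.

(** If x does not divide g, then g is a unit times y^j modulo x, and
    x f = y g makes y^(j+1) a multiple of x. *)
Lemma parameters_regular x y :
  krull_dimension R 2 -> m = ideal_gen [set x; y] ->
  [/\ x != 0, y != 0 & regular_pair x y].
Proof.
move=> /exists_intermediate_prime[Q [Qprime Qm Qnz]] mxy.
have myx : m = ideal_gen [set y; x] by rewrite mxy setUC.
have yX N : ~ multiples x (y ^+ N) by apply: parameter_not_nilpotent Qnz.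
have xX N : ~ multiples y (x ^+ N) by apply: parameter_not_nilpotent Qnz.
split.
- by apply/eqP => x0; apply: (xX 1%N); exists 0; rewrite x0; ring.
- by apply/eqP => y0; apply: (yX 1%N); exists 0; rewrite y0; ring.
move=> f g E; have [[h ->]|[j [u [mu [h gE]]]]] := parameter_expansion mxy g.
  by exists h; rewrite mulrC.
have [w wu] := local_unit noethR locR mu.
case: (yX j.+1); exists (w * (f - y * h)).
have <- : w * (u * y ^+ j.+1) = y ^+ j.+1 by rewrite mulrA wu mul1r.
rewrite -mulrA; congr (w * _); rewrite mulrBl [f * x]mulrC E.
have -> : u * y ^+ j.+1 = y * (g - (g - u * y ^+ j)) by rewrite exprS; ring.
rewrite gE; ring.
Qed.

End SystemOfParameters.

(** * Fitting ideals *)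

Section Fitting.
Variable R : comNzRingType.

(** What Laplace expansion along the last n columns would give; expanding along
    the first column, one column at a time, is enough. *)
Lemma det_in_ideal_of_minors (J : set R) q n (Z : 'M[R]_(q + n)) : is_ideal J ->
  (forall f : 'I_n -> 'I_(q + n),
    J (\det (\matrix_(i, j) Z (f i) (rshift q j)))) ->
  J (\det Z).
Proof.
move=> idJ; elim: q => [|q IHq] in Z *.
  move=> /(_ id); congr (J (\det _)); apply/matrixP => i j; rewrite mxE.
  by congr (Z _ _); apply: val_inj.
move=> JZ; rewrite (expand_det_col Z ord0); apply: ideal_sum => // i.
rewrite /cofactor mulrA; apply: idealMl => //; apply: IHq => f.
have := JZ (lift i \o f); congr (J (\det _)); apply/matrixP => i' j.
by rewrite !mxE; congr (Z _ _); apply: val_inj.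
Qed.

Definition determinantal_ideal n (N : set 'cV[R]_n) : set R :=
  ideal_gen [set \det U | U in [set U : 'M[R]_n | forall j, N (col j U)]].

(** Fitting's lemma, comparing arbitrary generators e_j of R^n / N with the
    standard basis. Let the rows of E be the e_j, so that the rows of B E are
    in N, and choose C with the rows of 1 - C E in N. The bordered matrix
    (B, B E; C, C E - 1) is (B, 0; C, -1) times a unipotent matrix, so it has
    the determinant of B up to sign, while all the rows of its last n columns
    are in N. *)
Lemma fitting0_column n (N : set 'cV[R]_n) : submod_closed [in N] ->
  fitting0 N = determinantal_ideal N.
Proof.
move=> [/set_mem N0 Nlin'].
have Nlin c u v : N u -> N v -> N (c *: u + v).
  by move=> Nu Nv; apply: set_mem; apply: (Nlin' c u v); apply/mem_set.
have idD := ideal_gen_ideal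
  [set \det U | U in [set U : 'M[R]_n | forall j, N (col j U)]].
apply/seteqP; split=> f.
  move=> [q [e [genN]]]; apply: ideal_gen_sub => // _ [B NB <-].
  have [C NC] : exists C : 'M[R]_(n, q),
      forall i, N (delta_mx i 0 - \sum_j C i j *: e j).
    have [c cP] := choice (fun i : 'I_n => genN (delta_mx i 0)).
    exists (\matrix_(i, j) c i j) => i.
    by under eq_bigr do rewrite mxE; apply: cP.
  pose E : 'M[R]_(q, n) := \matrix_(j, l) e j l 0.
  pose T := block_mx B (B *m E) C (C *m E - 1%:M).
  have -> : \det B = (-1) ^+ n * \det T.
    have -> : T = block_mx B 0 C (- 1%:M) *m block_mx 1%:M E 0 1%:M.
      by rewrite mulmx_block !mulmx1 !mulmx0 !addr0 ?add0r.
    rewrite det_mulmx det_lblock det_ublock !det1 !mulr1.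
    rewrite -scaleN1r scalemx1 det_scalar mulrCA -exprD addnn -mul2n exprM.
    by rewrite sqrrN !expr1n mulr1.
  apply: idealMl => //; apply: det_in_ideal_of_minors => // s.
  rewrite -det_tr; apply: ideal_gen_incl.
  exists (\matrix_(j, i) T (s i) (rshift q j)).
    move=> i /=; have [j sE|j sE] := splitP (s i).
      have {}sE : s i = lshift n j by apply: val_inj.
      have := NB j; congr N; apply/matrixP => l z.
      rewrite [RHS]mxE [RHS]mxE sE ord1 [RHS]block_mxEur mxE summxE.
      by apply: eq_bigr => h _; rewrite !mxE.
    have {}sE : s i = rshift q j by apply: val_inj.
    have := Nlin (-1) _ _ (NC j) N0; congr N; apply/matrixP => l z.
    rewrite [RHS]mxE [RHS]mxE sE ord1 [RHS]block_mxEdr !mxE summxE addr0.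
    rewrite mulN1r opprB eqxx andbT eq_sym; congr (_ - _).
    by apply: eq_bigr => h _; rewrite !mxE.
  by congr (\det _); apply/matrixP => i j; rewrite !mxE.
move=> Df; exists n, (fun j => delta_mx j 0); split=> [g|].
  exists (fun j => g j 0); congr N: N0; apply/matrixP => i z.
  rewrite !mxE summxE (bigD1 i) //= big1 => [|j ji]; rewrite !mxE ord1 ?eqxx.
    by rewrite mulr1 addr0 subrr.
  by rewrite eq_sym (negPf ji) mulr0.
move: f Df; apply: ideal_gen_sub; first exact: ideal_gen_ideal.
move=> _ [U NU <-]; apply: ideal_gen_incl; exists U^T; last exact: det_tr.
move=> i /=; have := NU i; congr N; apply/matrixP => l z.
rewrite ord1 !mxE summxE (bigD1 l) //= big1 => [|j jl]; rewrite !mxE ?eqxx.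
  by rewrite mulr1 addr0.
by rewrite eq_sym (negPf jl) mulr0.
Qed.

(** For N the full preimage of N', psi identifies G / N with G' / N', and
    generators can be pushed forward or lifted along psi. *)
Lemma fitting0_surj (G G' : lmodType R) (psi : {linear G -> G'}) (N : set G)
    (N' : set G') :
  (forall g', exists g, psi g = g') -> (forall g, N g <-> N' (psi g)) ->
  fitting0 N = fitting0 N'.
Proof.
move=> surj NN'; have psi_sum n (c : 'I_n -> R) (e : 'I_n -> G) :
    psi (\sum_j c j *: e j) = \sum_j c j *: psi (e j).
  by rewrite linear_sum; apply: eq_bigr => j _; rewrite linearZ.
have N_sub n (c : 'I_n -> R) (e : 'I_n -> G) g :
    N (g - \sum_j c j *: e j) <-> N' (psi g - \sum_j c j *: psi (e j)).
  by rewrite -psi_sum -linearB; apply: NN'.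
have Brel n (e : 'I_n -> G) :
    [set B : 'M[R]_n | forall i, N (\sum_j B i j *: e j)] =
    [set B : 'M[R]_n | forall i, N' (\sum_j B i j *: psi (e j))].
  apply/seteqP; split=> B /= NB i; first by rewrite -psi_sum; apply/NN'.
  by apply/NN'; rewrite psi_sum.
apply/seteqP; split=> f [n [e [gen_e f_e]]].
  exists n, (psi \o e); split=> [g'|]; last by rewrite -Brel.
  by have [g <-] := surj g'; have [c /N_sub] := gen_e g; exists c.
have [e' e'E] := choice (fun j => surj (e j)).
have {}e'E : e = psi \o e' by apply/funext => j; rewrite /= e'E.
exists n, e'; split=> [g|]; last by rewrite Brel; rewrite e'E in f_e.
by have [c Nc] := gen_e (psi g); exists c; apply/N_sub; rewrite e'E in Nc.
Qed.

End Fitting.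

(** * The double dual of a submodule of a free module *)

Section Forms.
Variables (R : comNzRingType) (U : lmodType R).

Lemma form_linear (phi : dual U) : linear (val phi).
Proof. by apply/asboolP; apply: (valP phi). Qed.

Lemma form_scale (phi : dual U) c u : val phi (c *: u) = c * val phi u.
Proof.
have phi0 : val phi 0 = 0.
  have := form_linear phi 1 0 0; rewrite !scale1r addr0.
  by move=> /(congr1 (fun z => z - val phi 0)); rewrite subrr addrK.
by have := form_linear phi c u 0; rewrite addr0 phi0 addr0.
Qed.

Lemma form_sum (phi : dual U) (T : finType) (F : T -> U) :
  val phi (\sum_i F i) = \sum_i val phi (F i).
Proof.
apply: (big_morph (val phi)) => [u v|]; last first.
  by rewrite -(scale0r (0 : U)) form_scale mul0r.
by have := form_linear phi 1 u v; rewrite !scale1r.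
Qed.

End Forms.

Section Bidual.
Variables (R : idomainType) (n p : nat) (A : 'M[R]_(n, p)) (s t : R).
Hypotheses (s_neq0 : s != 0) (regst : regular_pair s t).
Hypothesis (sF : forall i, colspan A (s *: delta_mx i 0)).
Hypothesis (tF : forall i, colspan A (t *: delta_mx i 0)).
Let U := colmodule A.

Definition col_of v (Av : colspan A v) : U := exist _ v (mem_set Av).

(** The forms on U extend to R^n. From t phi(s e_i) = s phi(t e_i) and the
    regularity of s, t, the value phi(s e_i) is divisible by s, and the quotient
    is the value c_i of the extension at e_i. *)
Lemma form_coefficients (phi : dual U) : exists c : 'I_n -> R,
  (forall i, val phi (col_of (sF i)) = s * c i) /\
  forall u, val phi u = \sum_i c i * val u i 0.
Proof.
have div i : exists c, val phi (col_of (sF i)) = s * c.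
  apply: (regst (f := val phi (col_of (tF i)))).
  rewrite -!form_scale; congr (val phi _); apply: val_inj => /=.
  by rewrite !scalerA mulrC.
have [c cE] := choice div; exists c; split=> // u; apply: (mulfI s_neq0).
rewrite -form_scale; have -> : s *: u = \sum_i val u i 0 *: col_of (sF i).
  apply: val_inj; rewrite [RHS]raddf_sum /=; apply/matrixP => i z.
  rewrite ord1 !mxE summxE (bigD1 i) //= big1 => [|j ji]; rewrite !mxE ?eqxx.
    by rewrite addr0 mulr1 mulrC.
  by rewrite eq_sym (negPf ji) !mulr0.
rewrite form_sum mulr_sumr; apply: eq_bigr => i _.
by rewrite form_scale cE; ring.
Qed.

Lemma coordinate_linear i :
  (fun u : U => val u i 0 : R^o) \in @linear_forms R U.
Proof. by apply/asboolP => c u v /=; rewrite !mxE. Qed.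

Definition coordinate i : dual U :=
  exist _ (fun u : U => val u i 0 : R^o) (coordinate_linear i).

Definition eval_coordinates (g : bidual U) : 'cV[R]_n :=
  \col_i val g (coordinate i).

Lemma eval_coordinates_linear : linear eval_coordinates.
Proof.
move=> c g h; apply/matrixP => i z; rewrite [LHS]mxE [RHS]mxE.
by rewrite [X in _ = X + _]mxE; congr (_ * _ + _); apply/esym/mxE.
Qed.

HB.instance Definition _ := GRing.isLinear.Build R (bidual U) 'cV[R]_n _ _
  eval_coordinates_linear.

(** The vector v is the evaluation of the extended forms at v. The extension is
    determined by s c_i = phi(s e_i), hence linear in phi. *)
Lemma eval_coordinates_surj v : exists g, eval_coordinates g = v.
Proof.
have [c cP] := choice form_coefficients.
pose g (phi : dual U) : R^o := \sum_i c phi i * v i 0.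
have g_lin : linear g.
  move=> d phi psi; rewrite /g scaler_sumr -big_split; apply: eq_bigr => i _ /=.
  rewrite /GRing.scale /= mulrA -mulrDl; congr (_ * _); apply: (mulfI s_neq0).
  by rewrite mulrDr mulrCA -!(cP _).1.
exists (exist _ g (introT (asboolP _) g_lin)); apply/matrixP => i z.
rewrite ord1 mxE /= /g (bigD1 i) //= big1 => [|j ji].
  rewrite addr0 -[RHS]mul1r; congr (_ * _); apply: (mulfI s_neq0).
  by rewrite -(cP _).1 /= !mxE !eqxx.
suff -> : c (coordinate i) j = 0 by rewrite mul0r.
by apply: (mulfI s_neq0); rewrite -(cP _).1 /= !mxE eq_sym (negPf ji) !mulr0.
Qed.

(** The coordinate forms generate the dual of U, so an element of the double
    dual is determined by its values on them. *)
Lemma eval_coordinates_in_module g :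
  range (@bidual_map R U) g <-> colspan A (eval_coordinates g).
Proof.
split=> [[u _ <-]|Ag].
  have -> : eval_coordinates (bidual_map u) = val u.
    by apply/matrixP => i z; rewrite ord1 !mxE.
  exact: set_mem (valP u).
exists (col_of Ag) => //; apply: val_inj; apply/funext => phi /=.
have [c [_ cE]] := form_coefficients phi.
have phiE : phi = \sum_i c i *: coordinate i.
  apply: val_inj; apply/funext => u; rewrite cE.
  by rewrite [in RHS]raddf_sum fct_sumE; apply: eq_bigr.
rewrite [LHS](cE (col_of Ag)) phiE form_sum; apply: eq_bigr => i _.
by rewrite form_scale /= mxE.
Qed.

Lemma ideal_of_colmodule : ideal_of_module U = determinantal_ideal (colspan A).
Proof.
rewrite -fitting0_column; last exact: colspan_submod.
apply: (fitting0_surj (psi := eval_coordinates)).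
  exact: eval_coordinates_surj.
exact: eval_coordinates_in_module.
Qed.

End Bidual.

(** * Integral closure and linear maps *)

Section IntegralClosureTheory.
Variable R : idomainType.
Local Notation K := {fraction R}.

Lemma integral_closure_linear (E E' : lmodType K) (phi : {linear E -> E'})
    (M : set E) (N : set E') f :
  (forall g, M g -> N (phi g)) -> integral_closure M f ->
  integral_closure N (phi f).
Proof.
move=> MN; have span_phi C : span_over C M f -> span_over C N (phi f).
  move=> [n [c [u [cu ->]]]]; exists n, c, (phi \o u); split=> [i|].
    by have [? /MN] := cu i.
  by rewrite linear_sum; apply: eq_bigr => i _; rewrite linearZ.
by move=> [/span_phi fK fV]; split=> // V dvrV RV; apply/span_phi/fV.
Qed.

Lemma integral_closure_incl (E : lmodType K) (M : set E) :
  M `<=` integral_closure M.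
Proof.
move=> f Mf; have span1 C : C 1 -> span_over C M f.
  by move=> C1; exists 1%N, (fun=> 1), (fun=> f); rewrite big_ord1 scale1r.
split=> [|V _ RV]; first exact: span1.
by apply: span1; apply: RV; exists 1; rewrite ?tofrac1.
Qed.

End IntegralClosureTheory.

(** * Modules of rank two of the form {u | det (w | u) in I} *)

Definition cross (R : comNzRingType) (u v : 'cV[R]_2) : R :=
  u 0 0 * v 1 0 - u 1 0 * v 0 0.

Lemma det_cross (R : comNzRingType) (U : 'M[R]_2) :
  \det U = cross (col 0 U) (col 1 U).
Proof.
rewrite (expand_det_col _ 0) !big_ord_recl big_ord0 /cofactor !det_mx11.
rewrite /cross !mxE.
have -> : lift 0 0 = 1 :> 'I_2 by apply: val_inj.
have -> : lift 1 0 = 0 :> 'I_2 by apply: val_inj.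
by rewrite expr0 expr1; ring.
Qed.

Definition pair_col (R : comNzRingType) (f g : R) : 'cV[R]_2 :=
  \col_i (if i == 0 then f else g).

Lemma cross_linear (R : comNzRingType) (u : 'cV[R]_2) :
  linear (cross u : 'cV[R]_2 -> R^o).
Proof. by move=> c v w; rewrite /cross !mxE /GRing.scale /=; ring. Qed.

HB.instance Definition _ (R : comNzRingType) (u : 'cV[R]_2) :=
  GRing.isLinear.Build R 'cV[R]_2 R^o _ (cross u) (cross_linear u).

Lemma ord2P (i : 'I_2) : i = 0 \/ i = 1.
Proof. by case: i => -[|[|//]] lti; [left|right]; apply: val_inj. Qed.

Lemma cV2P (R : comNzRingType) (u v : 'cV[R]_2) :
  u 0 0 = v 0 0 -> u 1 0 = v 1 0 -> u = v.
Proof.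
by move=> uv0 uv1; apply/matrixP => i j; rewrite ord1; case: (ord2P i) => ->.
Qed.

Lemma col_pair (R : comNzRingType) (u v : 'cV[R]_2) :
  col 0 (row_mx u v : 'M_2) = u /\ col 1 (row_mx u v : 'M_2) = v.
Proof.
have -> : 0 = @lshift 1 1 0 :> 'I_2 by apply: val_inj.
have -> : 1 = @rshift 1 1 0 :> 'I_2 by apply: val_inj.
by split; [apply: etrans (colKl _ _ _) _|apply: etrans (colKr _ _ _) _];
  rewrite col_id.
Qed.

Lemma pair_col_mx (R : comNzRingType) (f g : R) :
  col_mx f%:M g%:M = pair_col f g :> 'cV_(1 + 1).
Proof.
apply/matrixP => i j; rewrite -(splitK i); case: (fintype.split i) => i' /=.
  by rewrite col_mxEu !mxE !ord1.
by rewrite col_mxEd !mxE !ord1.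
Qed.

(** In the application P is generated by the x^(a_i - 1) y^(b_i) with i < r,
    d = b_r - k and N = a_0 - 1. *)
Section RankTwoModule.
Variables (R : idomainType) (x y : R) (k d N q : nat) (P I : set R).
Variable A : 'M[R]_(2, q).
Hypotheses (x_neq0 : x != 0) (y_neq0 : y != 0) (regxy : regular_pair x y).
Hypotheses (idP : is_ideal P) (idI : is_ideal I).
Hypothesis A_span : forall v, colspan A v <->
  exists p h s, [/\ P p, v 0 0 = p + y ^+ k * h & v 1 0 = x * h + y ^+ d * s].
Hypothesis I_P : forall f,
  I f <-> exists p s, P p /\ f = x * p + y ^+ (k + d) * s.
Hypothesis P_ydI : forall p, P p -> I (y ^+ d * p).
Hypothesis P_xN : P (x ^+ N).
Local Notation iota := (@tofrac R).

(** In the product of two general elements the terms in x y^k h h' cancel; what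
    is left are multiples of x P, of y^d P and of y^(k + d). *)
Lemma cross_in u v : colspan A u -> colspan A v -> I (cross u v).
Proof.
move=> /A_span[p [h [s [Pp u0 u1]]]] /A_span[p' [h' [s' [Pp' v0 v1]]]].
have Ix g : P g -> I (x * g).
  by move=> Pg; apply/I_P; exists g, 0; split=> //; ring.
have Iy : I (y ^+ (k + d)).
  by apply/I_P; exists 0, 1; split; [exact: ideal0|ring].
rewrite /cross u0 u1 v0 v1.
have -> : (p + y ^+ k * h) * (x * h' + y ^+ d * s') -
    (x * h + y ^+ d * s) * (p' + y ^+ k * h') =
    h' * (x * p) + s' * (y ^+ d * p) - h * (x * p') - s * (y ^+ d * p') +
    (h * s' - h' * s) * y ^+ (k + d) by rewrite exprD; ring.
apply: idealD => //; last exact: idealMl.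
apply: idealB => //; last by apply: idealMl => //; apply: P_ydI.
apply: idealB => //; last by apply: idealMl => //; apply: Ix.
by apply: idealD => //; apply: idealMl => //; [apply: Ix|apply: P_ydI].
Qed.

Lemma w_in_span : colspan A (pair_col (y ^+ k) x).
Proof.
apply/A_span; exists 0, 1, 0; rewrite !mxE /=; split; [|ring|ring].
exact: ideal0.
Qed.

(** The column (- p, y^d s) is sent to x p + y^(k + d) s. *)
Lemma cross_onto f :
  I f -> exists2 u, colspan A u & f = cross (pair_col (y ^+ k) x) u.
Proof.
move=> /I_P[p [s [Pp ->]]]; exists (pair_col (- p) (y ^+ d * s)).
  apply/A_span; exists (- p), 0, s; rewrite !mxE /=; split; [|ring|ring].
  by rewrite -mulN1r; apply: idealMl.
by rewrite /cross !mxE /= exprD; ring.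
Qed.

Lemma determinantal_ideal_rank2 : determinantal_ideal (colspan A) = I.
Proof.
apply/seteqP; split=> [|f /cross_onto[u Au ->]].
  apply: ideal_gen_sub => // _ [U AU <-]; rewrite det_cross; exact: cross_in.
have [col0 col1] := col_pair (pair_col (y ^+ k) x) u.
apply: ideal_gen_incl; exists (row_mx (pair_col (y ^+ k) x) u : 'M_2).
  move=> j /=; case: (ord2P j) => ->; rewrite ?col0 ?col1 //.
  exact: w_in_span.
by rewrite det_cross col0 col1.
Qed.

(** The regular sequence x^(N + 1), y^(k + d) multiplies R^2 into the module:
    for instance (0, x^(N + 1)) = x^N w - y^k (x^N, 0). *)
Lemma ideal_of_rank2 : ideal_of_module (colmodule A) = I.
Proof.
rewrite -determinantal_ideal_rank2.
apply: (ideal_of_colmodule (expf_neq0 N.+1 x_neq0)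
  (regular_pairX (p := N.+1) (q := k + d) x_neq0 y_neq0 regxy)) => i.
  apply/A_span; case: (ord2P i) => ->.
    exists (x * x ^+ N), 0, 0; rewrite !mxE /= exprS; split; [|ring|ring].
    exact: idealMl.
  exists (- y ^+ k * x ^+ N), (x ^+ N), 0; rewrite !mxE /= exprS.
  split; [|ring|ring].
  exact: idealMl.
apply/A_span; case: (ord2P i) => ->.
  exists 0, (y ^+ d), (- x); rewrite !mxE /= exprD; split; [|ring|ring].
  exact: ideal0.
exists 0, 0, (y ^+ k); rewrite !mxE /= exprD; split; [|ring|ring].
exact: ideal0.
Qed.

(** An integral element f has cross c f in I for every c in the module. The
    choice c = w gives f = (- p, y^d s) + h w with h in the fraction field; the
    choices (0, y^d) and (x^N, 0) bound the denominator of h by y^(k + d) and by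
    x^(N + 1), and these two form a regular sequence. *)
Lemma integrally_closed_rank2 :
  integrally_closed_ideal I -> integrally_closed_columns A.
Proof.
move=> clI; apply/seteqP; split; last exact: integral_closure_incl.
move=> f clf.
have cross_f c : colspan A c ->
    exists2 i, I i & iota i = cross (map_mx iota c) f.
  move=> Ac; suff : integral_closure (iota @` I : set {fraction R}^o)
      (cross (map_mx iota c) f).
    by rewrite clI => -[i]; exists i.
  apply: integral_closure_linear clf => _ [u Au <-].
  exists (cross c u); first exact: cross_in.
  by rewrite /= /cross !mxE rmorphB !rmorphM.
have [_ /I_P[p [s [Pp ->]]] E1] := cross_f _ w_in_span.
have [|j _ E2] := cross_f (pair_col 0 (y ^+ d)).
  apply/A_span; exists 0, 0, 1; rewrite !mxE /=; split; [|ring|ring].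
  exact: ideal0.
have [|j' _ E3] := cross_f (pair_col (x ^+ N) 0).
  by apply/A_span; exists (x ^+ N), 0, 0; rewrite !mxE /=; split; [|ring|ring].
move: E1 E2 E3.
rewrite /cross !mxE /= !(rmorphD, rmorphM, rmorphXn, rmorph0) exprD /=.
set X := iota x; set Y := iota y; set f0 := f 0 0; set f1 := f 1 0.
rewrite mul0r mul0r sub0r subr0 => E1 E2 E3.
have X_neq0 : X != 0 by rewrite tofrac_eq0.
have Y_neq0 : Y != 0 by rewrite tofrac_eq0.
pose h := (f1 - Y ^+ d * iota s) / X.
have f1E : f1 = X * h + Y ^+ d * iota s by rewrite mulrC divfK ?subrK.
have f0E : f0 = - iota p + Y ^+ k * h.
  apply: (mulfI X_neq0).
  transitivity (Y ^+ k * f1 - (Y ^+ k * f1 - X * f0)); first by ring.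
  by rewrite -E1 f1E; ring.
pose al := j' - x ^+ N * y ^+ d * s.
pose be := y ^+ d * p - j.
have hX : X ^+ N.+1 * h = iota al.
  by rewrite /al rmorphB !rmorphM !rmorphXn /= E3 f1E exprS; ring.
have hY : Y ^+ (k + d) * h = iota be.
  by rewrite /be rmorphB rmorphM rmorphXn /= E2 f0E exprD; ring.
have [|c alE] := regular_pairX (p := N.+1) (q := k + d) x_neq0 y_neq0 regxy
    (f := be) (g := al).
  apply/eqP; rewrite -tofrac_eq !rmorphM !rmorphXn /= -hX -hY; apply/eqP; ring.
have hE : h = iota c.
  by apply: (mulfI (expf_neq0 N.+1 X_neq0)); rewrite hX alE rmorphM rmorphXn.
exists (pair_col (- p + y ^+ k * c) (x * c + y ^+ d * s)).
  apply/A_span; exists (- p), c, s; rewrite !mxE; split=> //.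
  by rewrite -mulN1r; apply: idealMl.
apply: cV2P; rewrite !mxE /= -/f0 -/f1 ?f0E ?f1E hE.
  by rewrite rmorphD rmorphN rmorphM rmorphXn.
by rewrite rmorphD !rmorphM rmorphXn.
Qed.

End RankTwoModule.

(** * Monomial ideals and their modules *)

Section Monomial.
Variables (R : comNzRingType) (x y : R) (r : nat) (a b : nat -> nat) (k : nat).

Definition top_row_ideal : set R :=
  ideal_gen (range (fun i : 'I_r => x ^+ (a i - 1) * y ^+ b i)).

Lemma monomial_module_span v :
  colspan (monomial_module_mx x y r a b k) v <->
  exists p h s, [/\ top_row_ideal p, v 0 0 = p + y ^+ k * h
                  & v 1 0 = x * h + y ^+ (b r - k) * s].
Proof.
have mulE (c : 'cV[R]_r) (h s : R) :
    monomial_module_mx x y r a b k *m col_mx c (col_mx h%:M s%:M) =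
    pair_col (\sum_i c i 0 * (x ^+ (a i - 1) * y ^+ b i) + y ^+ k * h)
             (x * h + y ^+ (b r - k) * s).
  rewrite /monomial_module_mx mul_block_col !mul_row_col !mul_scalar_mx.
  rewrite !mul0mx add0r addr0 -pair_col_mx; congr col_mx;
    apply/matrixP => i j; rewrite !ord1 !mxE !mulr1n //.
  by congr (_ + _); apply: eq_bigr => l _; rewrite !mxE mulrC.
split=> [[u _ <-]|[p [h [s [/ideal_gen_family[c pE] v0 v1]]]]].
  rewrite -[u]vsubmxK -[dsubmx u]vsubmxK [usubmx (dsubmx u)]mx11_scalar.
  rewrite [dsubmx (dsubmx u)]mx11_scalar mulE !mxE /=.
  do 3!eexists; split; [|reflexivity|reflexivity].
  by apply/ideal_gen_family; eexists; reflexivity.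
exists (col_mx (\col_i c i) (col_mx h%:M s%:M)) => //; rewrite mulE.
apply: cV2P; rewrite mxE /= ?v0 ?v1 // pE; congr (_ + _).
by apply: eq_bigr => i _; rewrite mxE.
Qed.

End Monomial.

Lemma increasing_gap (b : nat -> nat) r i j :
  (forall l, (l < r)%N -> (b l < b l.+1)%N) -> (i <= j <= r)%N ->
  (b i + (j - i) <= b j)%N.
Proof.
move=> b_incr; elim: j => [|j IHj] /andP[leij lejr].
  by have -> : i = 0%N by [lia]; rewrite subn0 addn0.
have [ltij|/eqP ->] : (i <= j)%N \/ i == j.+1 by lia.
  by have := b_incr _ lejr; have := IHj; lia.
lia.
Qed.

Section MonomialIdeal.
Variables (R : comNzRingType) (x y : R) (r : nat) (a b : nat -> nat).
Let I := ideal_gen [set x ^+ a i * y ^+ b i | i in [set i | (i <= r)%N]].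
Let P := top_row_ideal x y r a b.

Lemma monomial_idealP f :
  (forall i, (i < r)%N -> (a i.+1 < a i)%N) -> a r = 0%N ->
  I f <-> exists p s, P p /\ f = x * p + y ^+ b r * s.
Proof.
move=> a_decr a_last; have idI : is_ideal I by apply: ideal_gen_ideal.
have idP : is_ideal P by apply: ideal_gen_ideal.
have xE i : (i < r)%N -> x * (x ^+ (a i - 1) * y ^+ b i) = x ^+ a i * y ^+ b i.
  move=> ltir; rewrite mulrA -exprS; congr (x ^+ _ * _).
  by have := a_decr _ ltir; lia.
split=> [|[p [s [Pp ->]]]].
  apply: (ideal_gen_sub
    (J := [set f | exists p s, P p /\ f = x * p + y ^+ b r * s])).
    apply/is_idealP; split; first by exists 0, 0; split; [exact: ideal0|ring].
    move=> c _ _ [p [s [Pp ->]]] [p' [s' [Pp' ->]]].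
    exists (c * p + p'), (c * s + s'); split; last by ring.
    by apply: idealD => //; apply: idealMl.
  move=> _ [i /= leir <-]; have [ltir|/eqP eqir] : (i < r)%N \/ i == r by lia.
    exists (x ^+ (a i - 1) * y ^+ b i), 0; rewrite xE //; split; last by ring.
    by apply: ideal_gen_incl; exists (Ordinal ltir).
  by exists 0, 1; rewrite eqir a_last; split; [exact: ideal0|ring].
apply: idealD => //; last first.
  rewrite mulrC; apply: idealMl => //; apply: ideal_gen_incl.
  by exists r; rewrite /= ?a_last ?mul1r.
move: p Pp; apply: (ideal_gen_sub (J := [set p | I (x * p)])).
  apply/is_idealP; split=> /=; first by rewrite mulr0; apply: ideal0.
  move=> c u v Iu Iv; have -> : x * (c * u + v) = c * (x * u) + x * v by ring.
  by apply: idealD => //; apply: idealMl.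
move=> _ [i _ <-] /=; rewrite xE ?ltn_ord //.
by apply: ideal_gen_incl; exists (i : nat) => //=; apply: ltnW.
Qed.

(** Multiplying x^(a_i - 1) y^(b_i) by y^(b_r - k) gives a multiple of the next
    generator x^(a_(i+1)) y^(b_(i+1)): the b_j increase by at least 1 at each
    step, so b_i + (b_r - b_(i+1)) >= i + (r - i - 1) >= k. *)
Lemma monomial_minor k p :
  (forall i, (i < r)%N -> (a i.+1 < a i)%N) ->
  (forall i, (i < r)%N -> (b i < b i.+1)%N) -> (k <= r - 1)%N ->
  P p -> I (y ^+ (b r - k) * p).
Proof.
move=> a_decr b_incr k_le; have idI : is_ideal I by apply: ideal_gen_ideal.
move: p; apply: (ideal_gen_sub (J := [set p | I (y ^+ (b r - k) * p)])).
  apply/is_idealP; split=> /=; first by rewrite mulr0; apply: ideal0.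
  move=> c u v Iu Iv.
  have -> : y ^+ (b r - k) * (c * u + v) =
    c * (y ^+ (b r - k) * u) + y ^+ (b r - k) * v by ring.
  by apply: idealD => //; apply: idealMl.
move=> _ [i _ <-] /=; have ltir := ltn_ord i.
have aE : (a i - 1 = (a i - 1 - a i.+1) + a i.+1)%N.
  by have := a_decr _ ltir; lia.
have bE : (b r - k + b i = (b r - k + b i - b i.+1) + b i.+1)%N.
  have := increasing_gap (i := i.+1) (j := r) b_incr.
  have := increasing_gap (i := 0) (j := i) b_incr; lia.
rewrite mulrCA -exprD aE bE !exprD mulrACA; apply: idealMl => //.
by apply: ideal_gen_incl; exists i.+1.
Qed.

End MonomialIdeal.

Theorem theorem3p6 (R : idomainType) (m : set R) (x y : R)
    (regR : regular_local_ring m 2)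
    (residue_infinite : infinite_set (residue_set m))
    (xy_parameters : m = ideal_gen [set x; y])
    (I : set R) (r : nat) (a b : nat -> nat)
    (a_decr : forall i, (i < r)%N -> (a i.+1 < a i)%N) (a_last : a r = 0%N)
    (b_first : b 0%N = 0%N) (b_incr : forall i, (i < r)%N -> (b i < b i.+1)%N)
    (I_gen : I = ideal_gen [set x ^+ a i * y ^+ b i | i in [set i | (i <= r)%N]])
    (I_primary : primary_to m I)
    (I_closed : integrally_closed_ideal I)
    (k : nat) (k_range : (1 <= k <= r - 1)%N) :
  integrally_closed_columns (monomial_module_mx x y r a b k) /\
  ideal_of_module (colmodule (monomial_module_mx x y r a b k)) = I.
Proof.
have [noethR locR dimR _] := regR.
have [x_neq0 y_neq0 regxy] := parameters_regular noethR locR dimR xy_parameters.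
have idP : is_ideal (top_row_ideal x y r a b) by apply: ideal_gen_ideal.
have idI : is_ideal I by rewrite I_gen; apply: ideal_gen_ideal.
have kbr : (k + (b r - k) = b r)%N.
  have := increasing_gap (i := 0) (j := r) b_incr; lia.
have I_P f : I f <-> exists p s, top_row_ideal x y r a b p /\
    f = x * p + y ^+ (k + (b r - k)) * s.
  by rewrite kbr I_gen; apply: monomial_idealP.
have P_ydI p : top_row_ideal x y r a b p -> I (y ^+ (b r - k) * p).
  by rewrite I_gen; apply: monomial_minor => //; case/andP: k_range.
have P_xN : top_row_ideal x y r a b (x ^+ (a 0%N - 1)).
  have r_gt0 : (0 < r)%N by lia.
  by apply: ideal_gen_incl; exists (Ordinal r_gt0); rewrite //= b_first mulr1.
have A_span := monomial_module_span x y r a b k.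
split.
  exact: (integrally_closed_rank2 x_neq0 y_neq0 regxy idP idI A_span I_P P_ydI
    P_xN).
exact: (ideal_of_rank2 x_neq0 y_neq0 regxy idP idI A_span I_P P_ydI P_xN).
Qed.
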